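(* Consider an MDP with finite state space $\mathcal{S}$, finite action sets $\mathcal{A}_s$ ($s\in\mathcal{S}$), transition kernel $p^S$, and nonempty set of absorbing states $\mathcal{S}^g\subset\mathcal{S}$. Let $\mathcal{D}=\{(s_i,a_i,r_i)\}_{i=1}^n$ be a dataset storing the unique (pairwise distinct) transitions, with $s_i\in\mathcal{S}\setminus\mathcal{S}^g$, $a_i\in\mathcal{A}_{s_i}$, $r_i\in\mathbb{R}$. Let $Q_\theta$ be of tabular form with index bijection $\nu$ and parameter $\theta\in\Theta=\mathbb{R}^{d_\Theta}$ (see context), let $\epsilon,\sigma>0$, and define $$p(\theta,r_{1:n}|s_{1:n},a_{1:n})=\prod_{i=1}^n\mathcal{N}\Big(r_i;\theta_{\nu(s_i,a_i)}-\sum_{s_i'\in\mathcal{S}}p^S(s_i'|s_i,a_i)\max_{a_i'\in\mathcal{A}_{s_i'}}\theta_{\nu(s_i',a_i')},\epsilon^2\Big)\prod_{j=1}^{d_\Theta}\mathcal{N}(\theta_j;0,\sigma^2),$$ $p(r_{1:n}|s_{1:n},a_{1:n})=\int_\Theta p(\theta,r_{1:n}|s_{1:n},a_{1:n})\,\mathrm{d}\theta$ and $p(\theta|\mathcal{D})=p(\theta,r_{1:n}|s_{1:n},a_{1:n})/p(r_{1:n}|s_{1:n},a_{1:n})$. Let $\mathcal{S}'^{\mathcal{D}}=\bigcup_{i=1}^n\mathrm{supp}(p^S(\cdot|s_i,a_i))$ and let $\ell'^{\mathcal{D}}$ be the set of all functions $\ell$ on $\mathcal{S}'^{\mathcal{D}}$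 with $\ell(s')\in\mathcal{A}_{s'}$ for all $s'\in\mathcal{S}'^{\mathcal{D}}$. For $\ell\in\ell'^{\mathcal{D}}$ define $$E^\ell=\Theta\cap\bigcap_{s'\in\mathcal{S}'^{\mathcal{D}},\,s'\notin\mathcal{S}^g}\ \bigcap_{a'\in\mathcal{A}_{s'},\,a'\neq\ell(s')}\{\theta\in\Theta\mid\theta_{\nu(s',a')}-\theta_{\nu(s',\ell(s'))}\le 0\},$$ let $B^\ell\in\mathbb{R}^{n\times d_\Theta}$ have entries $$B^\ell_{i,j}=\mathbb{1}(j=\nu(s_i,a_i))-\sum_{s'\in\mathcal{S}'^{\mathcal{D}}}p^S(s'|s_i,a_i)\,\mathbb{1}(j=\nu(s',\ell(s'))),$$ and set $\Gamma^\ell=(\sigma^2B^\ell(B^\ell)^T+\epsilon^2I_n)^{-1}$, $\mu^\ell_{\theta|r}=\sigma^2(B^\ell)^T\Gamma^\ell r_{1:n}$, $\Sigma^\ell_{\theta|r}=\sigma^2I_{d_\Theta}-\sigma^4(B^\ell)^T\Gamma^\ell B^\ell$. Then $$p(r_{1:n}|s_{1:n},a_{1:n})=\sum_{\ell\in\ell'^{\mathcal{D}}}\mathcal{N}(r_{1:n};0,(\Gamma^\ell)^{-1})\int_{E^\ell}\mathcal{N}(\theta;\mu^\ell_{\theta|r},\Sigma^\ell_{\theta|r})\,\mathrm{d}\theta,$$ and for any (measurable) $E^*\subseteq\Theta$, $$p(\theta\in E^*|\mathcal{D})=\big(p(r_{1:n}|s_{1:n},a_{1:n})\big)^{-1}\sum_{\ell\in\ell'^{\mathcal{D}}}\mathcal{N}(r_{1:n};0,(\Gamma^\ell)^{-1})\int_{E^*\cap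 E^\ell}\mathcal{N}(\theta;\mu^\ell_{\theta|r},\Sigma^\ell_{\theta|r})\,\mathrm{d}\theta.$$
   Context: An MDP has a finite state space $\mathcal{S}$, nonempty finite sets $\mathcal{A}_s$ of admissible actions for each $s\in\mathcal{S}$, and transition probabilities $p^S(\cdot|s,a)$ on $\mathcal{S}$. Write $\mathcal{S}\otimes\mathcal{A}=\bigcup_{s\in\mathcal{S}}\{s\}\times\mathcal{A}_s$ and $(\mathcal{S}\setminus\mathcal{S}^g)\otimes\mathcal{A}=\bigcup_{s\in\mathcal{S}\setminus\mathcal{S}^g}\{s\}\times\mathcal{A}_s$. $\mathcal{S}^g$ is the set of absorbing states: each $s^g\in\mathcal{S}^g$ has a single admissible action $a^g$, with $p^S(s^g|s^g,a^g)=1$ (and zero reward). Tabular form: $d_\Theta=|(\mathcal{S}\setminus\mathcal{S}^g)\otimes\mathcal{A}|$, and $\nu:\mathcal{S}\otimes\mathcal{A}\to\{1,\dots,d_\Theta+|\mathcal{S}^g|\}$ is a bijection with $\nu(s^g,a^g)\in\{d_\Theta+1,\dots,d_\Theta+|\mathcal{S}^g|\}$ for every $s^g\in\mathcal{S}^g$, $a^g\in\mathcal{A}_{s^g}$. For $\theta\in\Theta$ and $j\in\{1,\dots,d_\Theta\}$, $\theta_j=Q_\theta(\nu^{-1}(j))$ is the $j$-th coordinate of $\theta$; by convention $\theta_k=Q_\theta(\nu^{-1}(k))\equiv0$ for $k\in\{d_\Theta+1,\dots,d_\Theta+|\mathcal{S}^g|\}$. $\mathcal{N}(x;m,C)$ denotes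 the (univariate or multivariate) Gaussian density at $x$ with mean $m$ and (co)variance $C$; $r_{1:n}=(r_1,\dots,r_n)^T$; $p(\theta\in E^*|\mathcal{D})=\int_{E^*}p(\theta|\mathcal{D})\,\mathrm{d}\theta$. *)

(* Defs.v *)
From HB Require Import structures.
From mathcomp Require Import all_boot all_order all_algebra.
From mathcomp Require Import all_classical all_reals all_analysis.
Set Implicit Arguments.
Unset Strict Implicit.
Unset Printing Implicit Defensive.
Import Order.TTheory GRing.Theory Num.Theory.
Import numFieldNormedType.Exports.
Local Open Scope classical_set_scope.
Local Open Scope ring_scope.

Section lebesgue_on_tuples.
Variable R : realType.

Definition tuple_consp n (xt : measurableTypeR R * n.-tuple (measurableTypeR R)) :
  n.+1.-tuple (measurableTypeR R) := [tuple of xt.1 :: xt.2].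

Lemma measurable_tuple_consp n : measurable_fun setT (@tuple_consp n).
Proof. exact: measurable_cons. Qed.

(* Adds one coordinate in front: image of the product measure under cons. *)
Definition lebesgue_cons n
    (mu : {measure set (n.-tuple (measurableTypeR R)) -> \bar R}) :
    set (n.+1.-tuple (measurableTypeR R)) -> \bar R :=
  pushforward (@lebesgue_measure R \x^ mu)%E (@tuple_consp n).

HB.instance Definition _ n
    (mu : {measure set (n.-tuple (measurableTypeR R)) -> \bar R}) :=
  Measure.copy (lebesgue_cons mu)
    (measure_function_pushforward__canonical__measure_function_Measure
       (@lebesgue_measure R \x^ mu)%E (@measurable_tuple_consp n)).

Fixpoint lebesgue_tuple (n : nat) :
    {measure set (n.-tuple (measurableTypeR R)) -> \bar R} :=
  match n with
  | 0%N => \d_ [tuple]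
  | m.+1 => lebesgue_cons (lebesgue_tuple m)
  end.

End lebesgue_on_tuples.

Definition col_of_tuple (R : realType) n (t : n.-tuple (measurableTypeR R)) :
  'cV[R]_n := \col_i tnth t i.

Definition mvnormal_pdf (R : realType) n (m : 'cV[R]_n) (C : 'M[R]_n)
    (x : 'cV[R]_n) : R :=
  (Num.sqrt ((2 * pi) ^+ n * \det C))^-1 *
  expR (- ((x - m)^T *m invmx C *m (x - m)) 0 0 / 2).

Record mdp (R : realType) := MDP {
  state : finType ;
  action : state -> finType ;
  action_gt0 : forall s, (0 < #|action s|)%N ;
  trans : {s : state & action s} -> state -> R ;
  trans_ge0 : forall sa s', 0 <= trans sa s' ;
  trans_sum1 : forall sa, \sum_(s' : state) trans sa s' = 1 ;
  goal : {set state} ;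
  goal_action1 : forall s, s \in goal -> #|action s| = 1%N ;
  goal_absorbing : forall s (a : action s),
    s \in goal -> trans (Tagged action a) s = 1
}.

Section bellman_posterior.
Variables (R : realType) (M : mdp R).

Definition state_action : finType := {s : state M & action s}.

Definition pair_of (s : state M) (a : action s) : state_action :=
  Tagged (@action R M) a.

Definition dTheta : nat := #|[set sa : state_action | tag sa \notin goal M]%SET|.

Definition Theta : measurableType _ :=
  dTheta.-tuple (measurableTypeR R).

Definition nu_index : finType := 'I_(dTheta + #|goal M|).

(* Indices start at 0, so the coordinates of theta are the k < dTheta and the
   last #|goal M| indices carry the value 0. *)
Definition coord (theta : Theta) (k : nu_index) : R :=
  match fintype.split k with
  | inl j => tnth theta j
  | inr _ => 0
  end.

Variable nu : state_action -> nu_index.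

Definition Qfun (theta : Theta) (sa : state_action) : R := coord theta (nu sa).

Definition action0 (s : state M) : action s :=
  enum_val (Ordinal (action_gt0 s)).

(* The initial value of the iterated maximum is itself one of the values, so
   this is the maximum over the nonempty type [action s]. *)
Definition maxQ (theta : Theta) (s : state M) : R :=
  \big[Num.max/Qfun theta (pair_of (action0 s))]_(a : action s)
    Qfun theta (pair_of a).

Variables (epsilon sigma : R) (n : nat) (D : n.-tuple (state_action * R)).

Definition sa_ (i : 'I_n) : state_action := (tnth D i).1.

Definition rew : 'cV[R]_n := \col_i (tnth D i).2.

(* [normal_pdf m s] takes the standard deviation [s], not the variance. *)
Definition joint (theta : Theta) : R :=
  (\prod_(i < n) normal_pdf
     (Qfun theta (sa_ i) - \sum_(s' : state M) trans (sa_ i) s' * maxQ theta s')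
     epsilon (rew i 0)) *
  \prod_(j < dTheta) normal_pdf 0 sigma (tnth theta j).

Definition marginal : \bar R :=
  (\int[lebesgue_tuple R dTheta]_theta (joint theta)%:E)%E.

Definition posterior (theta : Theta) : \bar R :=
  ((joint theta)%:E / marginal)%E.

Definition posterior_prob (E : set Theta) : \bar R :=
  (\int[lebesgue_tuple R dTheta]_(theta in E) posterior theta)%E.

Definition next_states : {set state M} :=
  (\bigcup_(i < n) [set s' | trans (sa_ i) s' != 0])%SET.

Definition next_state : finType := {s' : state M | s' \in next_states}.

Definition selector : finType :=
  {dffun forall s' : next_state, action (val s')}.

Definition selected (l : selector) (s' : next_state) : state_action :=
  pair_of (l s').

Definition Ecell (l : selector) : set Theta :=
  \bigcap_(s' in [set s' : next_state | val s' \notin goal M])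
  \bigcap_(a' in [set a' : action (val s') | a' != l s'])
    [set theta | coord theta (nu (pair_of a')) -
                 coord theta (nu (selected l s')) <= 0].

Definition Bmx (l : selector) : 'M[R]_(n, dTheta) :=
  \matrix_(i < n, j < dTheta)
    ((lshift #|goal M| j == nu (sa_ i))%:R -
     \sum_(s' : next_state)
        trans (sa_ i) (val s') * (lshift #|goal M| j == nu (selected l s'))%:R).

Definition Gammamx (l : selector) : 'M[R]_n :=
  invmx (sigma ^+ 2 *: (Bmx l *m (Bmx l)^T) + (epsilon ^+ 2)%:M).

Definition mu_post (l : selector) : 'cV[R]_dTheta :=
  sigma ^+ 2 *: ((Bmx l)^T *m Gammamx l *m rew).

Definition Sigma_post (l : selector) : 'M[R]_dTheta :=
  (sigma ^+ 2)%:M - sigma ^+ 4 *: ((Bmx l)^T *m Gammamx l *m Bmx l).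

End bellman_posterior.

(* Main.v *)
(* On the cell of a selector l every maximum over actions is attained at the
   action chosen by l, so the mean of the rewards is the linear map B^l theta
   and the joint density is a Gaussian prior times a Gaussian likelihood with
   linear mean. Such a product factors as the marginal density of the rewards,
   which does not depend on theta, times the conditional density of theta.
   The cells cover the parameter space and two of them only meet on a tie
   between two distinct coordinates, i.e. on a Lebesgue-null hyperplane, so the
   integral of the joint density splits as a sum over the cells. *)
Require Import Defs.
From mathcomp Require Import all_boot all_order all_algebra.
From mathcomp Require Import all_classical all_reals all_analysis.
From mathcomp Require Import measurable_realfun ring.

Set Implicit Arguments.
Unset Strict Implicit.
Unset Printing Implicit Defensive.
Import Order.TTheory GRing.Theory Num.Theory.

Local Open Scope classical_set_scope.
Local Open Scope ring_scope.

(** * Determinants of regularized Gram matrices *)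

(** Sylvester's determinant identity: left multiplication by a unipotent block matrix eliminates
    either off-diagonal block of [K], leaving one side or the other as its determinant. *)
Lemma det_add1_mulC (R : comNzRingType) (m n : nat)
  (U : 'M[R]_(m, n)) (V : 'M[R]_(n, m)) :
  \det (1%:M + U *m V) = \det (1%:M + V *m U).
Proof.
pose K := block_mx 1%:M (- U) V 1%:M.
have -> : \det (1%:M + U *m V) = \det K.
  have -> : \det (1%:M + U *m V) = \det (block_mx 1%:M U 0 1%:M *m K).
    rewrite mulmx_block !mul1mx !mul0mx !mulmx1 !add0r addNr det_lblock.
    by rewrite det1 mulr1.
  by rewrite det_mulmx det_ublock !det1 !mul1r.
have -> : \det (1%:M + V *m U) = \det (block_mx 1%:M 0 (- V) 1%:M *m K).
  rewrite mulmx_block !mul1mx !mul0mx !mulmx1 !addr0 addNr det_ublock.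
  by rewrite det1 mul1r mulNmx mulmxN opprK addrC.
by rewrite det_mulmx det_lblock !det1 !mul1r.
Qed.

Lemma mulmx_tr_self_ge0 (R : realDomainType) (n : nat) (v : 'rV[R]_n) :
  0 <= (v *m v^T) 0 0.
Proof. by rewrite mxE sumr_ge0// => i _; rewrite mxE -expr2 sqr_ge0. Qed.

Lemma mulmx_tr_self_gt0 (R : realDomainType) (n : nat) (v : 'rV[R]_n) :
  v != 0 -> 0 < (v *m v^T) 0 0.
Proof.
move=> v0; rewrite lt_neqAle mulmx_tr_self_ge0 andbT eq_sym.
apply: contra v0; rewrite mxE psumr_eq0 => [/allP v0|i _]; last first.
  by rewrite mxE -expr2 sqr_ge0.
apply/eqP/rowP => i; apply/eqP; rewrite mxE.
by have := v0 i (mem_index_enum i); rewrite mxE mulf_eq0 orbb.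
Qed.

(** A nonzero left kernel vector [v] would give [s |vB|^2 + t |v|^2 = 0], although the second term
    is positive. *)
Lemma det_gram_neq0 (R : realFieldType) (m n : nat) (B : 'M[R]_(m, n))
  (s t : R) : 0 <= s -> 0 < t -> \det (s *: (B *m B^T) + t%:M) != 0.
Proof.
move=> s0 t0; apply/det0P => -[v v0 /(congr1 (fun w => (w *m v^T) 0 0))].
rewrite mul0mx [RHS]mxE mulmxDr mulmxDl -scalemxAr mulmxA -scalemxAl.
rewrite -[v *m B *m B^T *m _]mulmxA -trmx_mul mul_mx_scalar -scalemxAl mxE.
rewrite [X in X + _]mxE [X in _ + X]mxE.
apply/eqP; rewrite gt_eqF// ltr_wpDl//.
  by rewrite mulr_ge0// mulmx_tr_self_ge0.
by rewrite mulr_gt0// mulmx_tr_self_gt0.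
Qed.

(* The determinant is a polynomial in [s] without nonnegative root, and it is
   positive at [s = 0]. *)
Lemma det_gram_gt0 (R : rcfType) (m n : nat) (B : 'M[R]_(m, n))
  (s t : R) : 0 <= s -> 0 < t -> 0 < \det (s *: (B *m B^T) + t%:M).
Proof.
move=> s0 t0.
pose p := \det ('X *: map_mx polyC (B *m B^T) + (t%:P)%:M : 'M[{poly R}]_m).
have pE x : p.[x] = \det (x *: (B *m B^T) + t%:M).
  rewrite -horner_evalE -det_map_mx; congr (\det _); apply/matrixP => i j.
  rewrite !mxE /= /horner_eval hornerD hornerM hornerX hornerC.
  by rewrite hornerMn hornerC.
rewrite ltNge; apply/negP => pos.
have [||x /andP[x0 _] /rootP] := @Num.Theory.poly_ivt R (- p) 0 s => //.
  by rewrite !hornerN oppr_ge0 oppr_le0 !pE pos scale0r add0r det_scalar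
     exprn_ge0// ltW.
move=> /eqP; rewrite hornerN oppr_eq0 pE.
by rewrite (negbTE (det_gram_neq0 _ _ _)).
Qed.

(** Gathers one constant and one exponent, the shape in which such a product can be compared with
    [mvnormal_pdf]. *)
Lemma prod_normal_pdf (R : realType) (n : nat) (m x : 'I_n -> R) (s : R) :
  0 < s ->
  \prod_(i < n) normal_pdf (m i) s (x i) =
  (Num.sqrt ((2 * pi * s ^+ 2) ^+ n))^-1 *
  expR (- (\sum_(i < n) (x i - m i) ^+ 2) / (2 * s ^+ 2)).
Proof.
move=> s0; have c0 : 0 <= 2 * pi * s ^+ 2 :> R.
  by rewrite mulr_ge0 ?sqr_ge0// mulr_ge0 ?pi_ge0.
elim: n m x => [|n IH] m x.
  by rewrite !big_ord0 oppr0 mul0r expR0 expr0 sqrtr1 invr1 mulr1.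
rewrite !big_ord_recl IH normal_pdfE ?gt_eqF// /normal_peak /normal_fun.
rewrite mulrACA -invfM -expRD [_ ^+ n.+1]exprS sqrtrM//; congr ((_ * _)^-1 * expR _).
  by congr Num.sqrt; rewrite -mulrnAr -mulr_natl mulrC.
by field; rewrite gt_eqF.
Qed.

(** * Conditioning in a linear Gaussian model *)

Section gaussian_conditioning.
Variables (R : realType) (n d : nat) (B : 'M[R]_(n, d)) (e s : R).
Hypotheses (e_gt0 : 0 < e) (s_gt0 : 0 < s).

(** For [r = B x + noise], with prior variance [s ^+ 2] and noise variance [e ^+ 2], [A] is the
    covariance of [r], and [S] and [P] are the covariance and precision of [x] given [r]. *)
Let A : 'M[R]_n := s ^+ 2 *: (B *m B^T) + (e ^+ 2)%:M.
Let G : 'M[R]_n := invmx A.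
Let S : 'M[R]_d := (s ^+ 2)%:M - s ^+ 4 *: (B^T *m G *m B).
Let P : 'M[R]_d := (s ^- 2)%:M + e ^- 2 *: (B^T *m B).

Let e_neq0 : e != 0. Proof. by rewrite gt_eqF. Qed.
Let s_neq0 : s != 0. Proof. by rewrite gt_eqF. Qed.

Let detA_gt0 : 0 < \det A.
Proof. by rewrite det_gram_gt0 ?exprn_gt0// exprn_ge0// ltW. Qed.

Let A_unit : A \in unitmx.
Proof. by rewrite unitmxE unitfE gt_eqF. Qed.

(** Solve the definition of [A] for [B *m B^T] and multiply by its inverse. The identities below use
    this to remove inner factors [B *m B^T]. *)
Let GBB : G *m (B *m B^T) = s ^- 2 *: (1%:M - e ^+ 2 *: G).
Proof.
have -> : B *m B^T = s ^- 2 *: (A - (e ^+ 2)%:M).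
  by rewrite /A addrK scalerA mulVf ?scale1r// expf_neq0.
by rewrite -scalemxAr mulmxBr mulVmx// mul_mx_scalar.
Qed.

Let Gsym : G^T = G.
Proof.
rewrite /G trmx_inv; congr invmx.
by rewrite /A linearD linearZ/= trmx_mul trmxK tr_scalar_mx.
Qed.

(* The Woodbury identity: [P] is the precision matrix of the posterior. *)
Let woodbury : S *m P = 1%:M.
Proof.
have XG : (B^T *m G *m B) *m (B^T *m B) =
    s ^- 2 *: (B^T *m B - e ^+ 2 *: (B^T *m G *m B)).
  rewrite -[B^T *m G *m B]mulmxA -mulmxA -[G *m B *m _]mulmxA [B *m (_ *m _)]mulmxA.
  rewrite [G *m _]mulmxA GBB -scalemxAl -scalemxAr mulmxBl mulmxBr mul1mx.
  by rewrite -scalemxAl -scalemxAr !mulmxA.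
rewrite /S /P mulmxBl !mulmxDr -!scalemxAl -!scalemxAr XG.
move: (B^T *m G *m B) (B^T *m B) => X Y.
rewrite -!scalar_mxM !mul_scalar_mx !mul_mx_scalar.
rewrite mulfV ?expf_neq0//.
apply/matrixP => i j; rewrite !mxE; move: (X i j) (Y i j) (_%:R) => x y k.
by field; rewrite e_neq0 s_neq0.
Qed.

Let S_unit : S \in unitmx.
Proof. by have /mulmx1_unit[] := woodbury. Qed.

Let invS : invmx S = P.
Proof. by rewrite -[LHS]mulmx1 -woodbury mulKmx. Qed.

(** Matches the normalizing constants: up to scalars [A] and [P] are [1 + UV] and [1 + VU], so they
    share a determinant factor, and [\det S] is the inverse of [\det P]. *)
Let det_prod : \det A * \det S = (e ^+ 2) ^+ n * (s ^+ 2) ^+ d.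
Proof.
pose c : R := s ^+ 2 / e ^+ 2.
have AE : A = e ^+ 2 *: (1%:M + (c *: B) *m B^T).
  rewrite scalerDr -scalemxAl scalerA /c mulrC divfK ?expf_neq0//.
  by rewrite scalemx1 addrC.
have PE : P = s ^- 2 *: (1%:M + B^T *m (c *: B)).
  rewrite scalerDr -scalemxAr scalerA scalemx1 /P; congr (_ + _ *: _).
  by rewrite /c; field; rewrite e_neq0 s_neq0.
have : \det S * \det P = 1 by rewrite -det_mulmx woodbury det1.
rewrite AE PE !detZ det_add1_mulC exprVn => SP.
rewrite -mulrA [X in _ * X]mulrC; congr (_ * _).
apply: (@mulIf _ ((s ^+ 2) ^- d)); first by rewrite invr_neq0// !expf_neq0.
by rewrite -mulrA [X in _ * X]mulrC SP mulfV ?expf_neq0.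
Qed.

(** The normal equation of the posterior mean. As [P] inverts [S], it suffices to expand [S] applied
    to the right-hand side. *)
Let P_mu (r : 'cV[R]_n) : P *m (s ^+ 2 *: (B^T *m G *m r)) = e ^- 2 *: (B^T *m r).
Proof.
rewrite -[e ^- 2 *: _]mul1mx -(mulmx1C woodbury) -[P *m S *m _]mulmxA; congr (_ *m _).
rewrite /S mulmxBl mul_scalar_mx -scalemxAl -scalemxAr.
rewrite -[_ *m B *m (_ *m r)]mulmxA [B *m (_ *m r)]mulmxA -[_ *m G *m (_ *m r)]mulmxA [G *m (_ *m r)]mulmxA GBB -scalemxAl -scalemxAr.
rewrite mulmxBl mulmxBr mul1mx -scalemxAl -scalemxAr mulmxA.
move: (B^T *m G *m r) (B^T *m r) => X Y.
apply/matrixP => i j; rewrite !mxE.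
by field; rewrite e_neq0 s_neq0.
Qed.

(* Completing the square around the posterior mean. *)
Let quad (r : 'cV[R]_n) (x : 'cV[R]_d) (mu := s ^+ 2 *: (B^T *m G *m r)) :
  r^T *m G *m r + (x - mu)^T *m P *m (x - mu) =
  e ^- 2 *: ((r - B *m x)^T *m (r - B *m x)) + s ^- 2 *: (x^T *m x).
Proof.
(* By [P_mu], [mu^T P mu] is [e ^- 2] times this quantity; its last term cancels [r^T G r]. *)
have muP : mu^T *m (B^T *m r) = r^T *m r - e ^+ 2 *: (r^T *m G *m r).
  rewrite /mu linearZ/= !trmx_mul trmxK Gsym -scalemxAl !mulmxA.
  rewrite -[r^T *m G *m B *m _]mulmxA -[r^T *m G *m _]mulmxA GBB.
  rewrite -scalemxAr -scalemxAl scalerA mulfV ?expf_neq0// scale1r.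
  by rewrite mulmxBr mulmx1 -scalemxAr mulmxBl -scalemxAl.
have Psym : P^T = P.
  by rewrite /P linearD linearZ/= trmx_mul trmxK tr_scalar_mx.
have muPx : mu^T *m (P *m x) = e ^- 2 *: (r^T *m (B *m x)).
  rewrite mulmxA -[P]Psym -trmx_mul P_mu linearZ/= trmx_mul trmxK.
  by rewrite -scalemxAl mulmxA.
rewrite -[(x - mu)^T *m P *m _]mulmxA mulmxBr P_mu mulmxBr.
rewrite !linearB/= !(mulmxBl, mulmxBr) muPx -!scalemxAr muP.
rewrite /P mulmxDl mul_scalar_mx mulmxDr -!scalemxAl -!scalemxAr !trmx_mul !mulmxA.
apply/matrixP => i j; rewrite !mxE.
by field; rewrite e_neq0 s_neq0.
Qed.
Let norm_sqE k (x : 'cV[R]_k) : (x^T *m x) 0 0 = \sum_i x i 0 ^+ 2.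
Proof. by rewrite mxE; apply: eq_bigr => i _; rewrite mxE expr2. Qed.

Lemma mvnormal_pdf_evidence_gt0 (r : 'cV[R]_n) : 0 < mvnormal_pdf 0 (invmx G) r.
Proof.
rewrite /mvnormal_pdf mulr_gt0 ?expR_gt0// invr_gt0 sqrtr_gt0 /G invmxK.
by rewrite mulr_gt0// exprn_gt0// mulr_gt0// pi_gt0.
Qed.

(** Each side is a constant times an exponential; the constants agree by [det_prod], the exponents
    by [quad]. *)
Lemma gaussian_conditioning (r : 'cV[R]_n) (x : 'cV[R]_d) :
  (\prod_(i < n) normal_pdf ((B *m x) i 0) e (r i 0)) *
  \prod_(j < d) normal_pdf 0 s (x j 0) =
  mvnormal_pdf 0 (invmx G) r *
  mvnormal_pdf (s ^+ 2 *: (B^T *m G *m r)) S x.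
Proof.
rewrite !prod_normal_pdf// /mvnormal_pdf subr0 invmxK invS {1}/G invmxK.
rewrite [LHS]mulrACA [RHS]mulrACA -!invfM -!expRD -!sqrtrM; last first.
- by rewrite exprn_ge0// mulr_ge0 ?sqr_ge0// mulr_ge0 ?pi_ge0.
- by rewrite mulr_ge0 ?(ltW detA_gt0)// exprn_ge0// mulr_ge0 ?pi_ge0.
congr ((Num.sqrt _)^-1 * expR _).
  by rewrite 2![(_ * _ ^+ 2) ^+ _]exprMn mulrACA [RHS]mulrACA det_prod.
have /(congr1 (fun M : 'M[R]_1 => M 0 0)) := quad r x.
rewrite /= [LHS]mxE [RHS]mxE [X in X + _ = _ -> _]/=.
rewrite [X in _ = X + _ -> _]mxE [X in _ = _ + X -> _]mxE !norm_sqE => q.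
have -> : \sum_(i < n) (r i 0 - (B *m x) i 0) ^+ 2 =
    \sum_i (r - B *m x) i 0 ^+ 2.
  by apply: eq_bigr => i _; rewrite !mxE.
rewrite -[RHS]mulrDl -[X in _ = X / _]opprD q.
have -> : \sum_(j < d) (x j 0 - 0) ^+ 2 = \sum_j x j 0 ^+ 2.
  by apply: eq_bigr => j _; rewrite subr0.
by field; rewrite e_neq0 s_neq0.
Qed.

End gaussian_conditioning.

(** * Linear hyperplanes are Lebesgue-null *)

Section null_hyperplane.
Variable R : realType.

Let hyperplane n (c : 'I_n -> R) : set (n.-tuple (measurableTypeR R)) :=
  [set t | \sum_(i < n) c i * tnth t i = 0].

Lemma measurable_linear_form n (c : 'I_n -> R) :
  measurable_fun setT
    (fun t : n.-tuple (measurableTypeR R) => \sum_(i < n) c i * tnth t i : R).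
Proof.
apply: measurable_sum => i; apply: measurable_funM => //.
exact: measurable_tnth.
Qed.

Lemma measurable_hyperplane n (c : 'I_n -> R) : measurable (hyperplane c).
Proof.
rewrite -[hyperplane c]setTI.
exact: (measurable_linear_form c measurableT (measurable_set1 0)).
Qed.

(** Slicing along the first coordinate, which allows induction on the dimension. *)
Lemma lebesgue_tupleS n (X : set (n.+1.-tuple (measurableTypeR R))) :
  (lebesgue_tuple R n.+1 X =
   \int[lebesgue_tuple R n]_t
     lebesgue_measure [set x : R | X [tuple of x :: t]])%E.
Proof.
rewrite /= /lebesgue_cons /pushforward /product_measure2.
apply: eq_integral => t _ /=; congr (lebesgue_measure _).
by apply/seteqP; split => x; rewrite /ysection /= inE.
Qed.

Lemma lebesgue_tuple_hyperplane n (c : 'I_n -> R) (i : 'I_n) : c i != 0 ->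
  lebesgue_tuple R n [set t | \sum_(j < n) c j * tnth t j = 0] = 0%E.
Proof.
elim: n c i => [c [] //|n IH c i ci0]; rewrite lebesgue_tupleS.
have consE x (t : n.-tuple (measurableTypeR R)) :
    \sum_(j < n.+1) c j * tnth [tuple of x :: t] j =
    c ord0 * x + \sum_(j < n) c (lift ord0 j) * tnth t j.
  rewrite big_ord_recl tnth0; congr (_ + _).
  by apply: eq_bigr => j _; rewrite tnthS.
under eq_integral => t _ do under eq_set => x do rewrite /= consE.
(* If the leading coefficient is nonzero, every slice is a single point. *)
have [c0|c0] := eqVneq (c ord0) 0; last first.
  apply: integral0_eq => t _.
  set y := \sum_(_ < _) _.
  suff -> : [set x : R | c ord0 * x + y = 0] = [set - y / c ord0].
    exact: lebesgue_measure_set1.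
  apply/seteqP; split => x /=.
    by move=> /eqP; rewrite addr_eq0 => /eqP <-; rewrite mulrC mulKf.
  by move=> ->; rewrite mulrC divfK// addNr.
have [j cj0] : exists j, c (lift ord0 j) != 0.
  case: (unliftP ord0 i) ci0 => [j ->|->]; first by exists j.
  by rewrite c0 eqxx.
have null := IH (fun k => c (lift ord0 k)) j cj0.
set N := [set t | _] in null.
have mN : measurable N by exact: measurable_hyperplane.
(* Otherwise a slice is the whole line over the lower-dimensional hyperplane [N] and empty
   elsewhere; [N] is null by induction, and [+oo * 0 = 0]. *)
transitivity (\int[lebesgue_tuple R n]_(t in N) (+oo : \bar R))%E.
  rewrite [RHS]integral_mkcond; apply: eq_integral => t _.
  rewrite patchE; case: ifPn => [/set_mem|/negP/(contra_not mem_set)] Nt.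
    rewrite [X in lebesgue_measure X](_ : _ = `]-oo, +oo[%classic).
      by rewrite lebesgue_measure_itv.
    by rewrite set_itvNyy; apply/seteqP; split => x //= _; rewrite c0 mul0r add0r.
  rewrite [X in lebesgue_measure X](_ : _ = set0) ?measure0//.
  by apply/seteqP; split => x //=; rewrite c0 mul0r add0r.
by rewrite integral_cst// null mule0.
Qed.

End null_hyperplane.

(** * Integrals over a partition up to a null set *)

Lemma ge0_integral_almost_partition d (T : measurableType d) (R : realType)
  (mu : {measure set T -> \bar R}) (I : finType) (F : I -> set T)
  (N E : set T) (f : T -> \bar R) :
  measurable E -> measurable N -> (forall i, measurable (F i)) ->
  measurable_fun setT f -> (forall x, 0 <= f x)%E ->
  mu N = 0%E -> (forall x, ~ N x -> exists! i, F i x) ->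
  (\int[mu]_(x in E) f x = \sum_(i : I) \int[mu]_(x in E `&` F i) f x)%E.
Proof.
move=> mE mN mF mf f0 N0 partF.
have mfE D : measurable D -> measurable_fun D f.
  by move=> mD; exact: measurable_funTS.
have mfF i D : measurable D -> measurable_fun D (f \_ (F i)).
  move=> mD; apply: measurable_funTS.
  by apply/(measurable_restrictT _ (mF i)); exact: mfE.
have fF0 i x : (0 <= (f \_ (F i)) x)%E by rewrite patchE; case: ifP.
(* Restricting the integrand instead of the domain brings all integrals to [E] minus [N], where the
   finite sum can be moved inside. *)
under eq_bigr => i _.
  rewrite integral_mkcondr (ge0_negligible_integral mN)//; last exact: mfF.
  over.
rewrite (ge0_negligible_integral mN)//; last exact: mfE.
have mEN : measurable (E `\` N) by exact: measurableD.
rewrite -ge0_integral_sum => [|//|i|//]; last exact: mfF.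
apply: eq_integral => x; rewrite inE => -[_ /partF[i [Fi uniq_i]]].
rewrite (bigD1 i)//= big1 ?adde0 => [|j ji].
  by rewrite patchE mem_set.
rewrite patchE memNset// => Fj; move/eqP: ji; apply.
by rewrite (uniq_i j).
Qed.

(** * Measurability of the ingredients of the joint density *)

Section measurability.
Context d (T : measurableType d) (R : realType).

Lemma measurable_bigmaxr (I : Type) (r : seq I) (f0 : T -> R) (f : I -> T -> R) :
  measurable_fun setT f0 -> (forall i, measurable_fun setT (f i)) ->
  measurable_fun setT (fun x => \big[Num.max/f0 x]_(i <- r) f i x).
Proof.
move=> mf0 mf; elim: r => [|i r IH].
  by under eq_fun do rewrite big_nil.
by under eq_fun do rewrite big_cons; exact: measurable_maxr.
Qed.

(** The density depends only on the squared difference, so mean and argument may be exchanged. *)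
Lemma measurable_normal_pdf_mean (s x : R) (f : T -> R) : s != 0 ->
  measurable_fun setT f -> measurable_fun setT (fun t => normal_pdf (f t) s x).
Proof.
move=> s0 mf; rewrite [X in measurable_fun _ X](_ : _ = normal_pdf x s \o f).
  exact: measurableT_comp (measurable_normal_pdf x s) mf.
apply/funext => t /=; rewrite !normal_pdfE// /normal_fun.
by rewrite -sqrrN opprB.
Qed.

End measurability.

(** * Selector cells and their ties *)

Section bellman_cells.
Variables (R : realType) (M : mdp R) (nu : state_action M -> nu_index M).
Variables (epsilon sigma : R) (n : nat) (D : n.-tuple (state_action M * R)).

(* [coord] alone would denote the basis coordinates of mathcomp's [vector]. *)
Lemma coordE (theta : Theta M) (k : nu_index M) :
  Defs.coord theta k =
  \sum_(j < dTheta M) (lshift #|goal M| j == k)%:R * tnth theta j.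
Proof.
rewrite /Defs.coord; case: (fintype.splitP k) => j kj.
  have -> : k = lshift #|goal M| j by exact: val_inj.
  rewrite (bigD1 j)//= eqxx mul1r big1 ?addr0// => i ij.
  by rewrite (inj_eq (@lshift_inj _ _)) (negbTE ij) mul0r.
rewrite big1// => i _; case: eqP => [/(congr1 val)/= ik|]; last by rewrite mul0r.
by have := ltn_ord i; rewrite ik kj ltnNge leq_addr.
Qed.

Lemma measurable_coord (k : nu_index M) :
  measurable_fun setT (fun theta : Theta M => Defs.coord theta k).
Proof.
under eq_fun do rewrite coordE; exact: measurable_linear_form.
Qed.

Lemma null_coord_tie (k1 k2 : nu_index M) : (k1 < dTheta M)%N -> k1 != k2 ->
  lebesgue_tuple R (dTheta M)
    [set theta : Theta M | Defs.coord theta k1 = Defs.coord theta k2] = 0%E.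
Proof.
move=> lt_k1 k12.
(* The tie is the hyperplane with these coefficients. The one at [k1] is 1; [k2] may be an index of
   constant value 0, whose indicator then vanishes for all [j]. *)
pose c (j : 'I_(dTheta M)) : R :=
  (lshift #|goal M| j == k1)%:R - (lshift #|goal M| j == k2)%:R.
have cE (theta : Theta M) : \sum_(j < dTheta M) c j * tnth theta j =
    Defs.coord theta k1 - Defs.coord theta k2.
  by rewrite !coordE -sumrB; apply: eq_bigr => j _; rewrite mulrBl.
have k1E : lshift #|goal M| (Ordinal lt_k1) = k1 by exact: val_inj.
rewrite -(@lebesgue_tuple_hyperplane R _ c (Ordinal lt_k1)); last first.
  by rewrite /c k1E eqxx (negbTE k12) subr0 oner_neq0.
congr (lebesgue_tuple _ _ _); apply/seteqP; split => theta /=; rewrite cE.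
  by move=> ->; rewrite subrr.
exact: subr0_eq.
Qed.

Lemma measurable_coord_tie (k1 k2 : nu_index M) :
  measurable [set theta : Theta M | Defs.coord theta k1 = Defs.coord theta k2].
Proof.
rewrite [X in measurable X](_ : _ =
    (fun theta : Theta M => Defs.coord theta k1 - Defs.coord theta k2) @^-1` [set 0]).
  rewrite -[X in measurable X]setTI; apply: measurable_funB => //;
    exact: measurable_coord.
by apply/seteqP; split => theta /=; [move=> ->; rewrite subrr|move/subr0_eq].
Qed.

(** By counting: the preimage of the first [dTheta M] indices contains only nongoal pairs and, by
    bijectivity, has as many elements as there are such pairs. *)
Lemma nu_nongoal (nu_bij : bijective nu)
  (nu_goal : forall sa, tag sa \in goal M -> (dTheta M <= nu sa)%N)
  (sa : state_action M) : tag sa \notin goal M -> (nu sa < dTheta M)%N.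
Proof.
pose L := [set k : nu_index M | (k < dTheta M)%N]%SET.
have cardL : #|L| = dTheta M.
  rewrite -[RHS]card_ord -(card_imset _ (@lshift_inj (dTheta M) #|goal M|)).
  congr #|pred_of_set _|; apply/setP => k; rewrite inE; apply/idP/imsetP.
    by move=> lt_k; exists (Ordinal lt_k) => //; exact: val_inj.
  by move=> [j _ ->] /=.
suff /eqP/setP/(_ sa) : (nu @^-1: L == [set sa | tag sa \notin goal M])%SET.
  by rewrite !inE => -> .
rewrite eqEcard (on_card_preimset (onW_bij _ nu_bij)) cardL leqnn andbT.
by apply/fintype.subsetP => x; rewrite !inE; apply: contraL => /nu_goal; rewrite -leqNgt.
Qed.

Lemma action_goal_unique (s : state M) (a b : action s) : s \in goal M -> a = b.
Proof.
by move=> /goal_action1/eqP/fintype1P[c ac]; rewrite (ac a) (ac b).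
Qed.

(** The constraints extend to all next states and actions: a goal state has only one action, and the
    selected action is compared with itself. *)
Lemma EcellP (l : selector D) (theta : Theta M) :
  Ecell nu l theta <-> forall (s' : next_state D) (a : action (val s')),
    Qfun nu theta (pair_of a) <= Qfun nu theta (selected l s').
Proof.
split => [cell s' a|le_l s' _ a _]; last by rewrite /= subr_le0; exact: le_l.
have [->//|al] := eqVneq a (l s').
have [goal_s|nongoal_s] := boolP (val s' \in goal M).
  by rewrite (action_goal_unique a (l s') goal_s).
by have := cell s' nongoal_s a al; rewrite /= subr_le0.
Qed.

Lemma measurable_Ecell (l : selector D) : measurable (Ecell nu l).
Proof.
apply: fin_bigcap_measurable => [|s' _]; first exact: finite_finset.
apply: fin_bigcap_measurable => [|a _]; first exact: finite_finset.
rewrite -[X in measurable X]setTI.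
have mf : measurable_fun setT (fun theta : Theta M =>
    Defs.coord theta (nu (pair_of a)) - Defs.coord theta (nu (selected l s'))).
  by apply: measurable_funB; exact: measurable_coord.
have := mf measurableT _ (measurable_itv `]-oo, 0]).
by congr (measurable (_ `&` _)); apply/seteqP; split => theta;
  rewrite /= in_itv.
Qed.

Lemma maxQ_Ecell (l : selector D) (theta : Theta M) (s' : next_state D) :
  Ecell nu l theta -> maxQ nu theta (val s') = Qfun nu theta (selected l s').
Proof.
move=> /EcellP/(_ s') max_l; apply/le_anti/andP; split.
  by apply: bigmax_le => [|a _]; exact: max_l.
exact: (le_bigmax _ (fun a => Qfun nu theta (pair_of a))).
Qed.

Lemma Bmx_Ecell (l : selector D) (theta : Theta M) (i : 'I_n) :
  Ecell nu l theta ->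
  (Bmx nu l *m col_of_tuple theta) i 0 =
  Qfun nu theta (sa_ D i) -
    \sum_(s' : state M) trans (sa_ D i) s' * maxQ nu theta s'.
Proof.
move=> cell; rewrite mxE.
under eq_bigr do rewrite !mxE mulrBl mulr_suml.
rewrite sumrB -coordE; congr (_ - _).
(* States outside [next_states D] have transition probability 0 from every pair in the data, so only
   next states remain. *)
rewrite exchange_big/= [RHS](bigID [in next_states D])/= [X in _ + X]big1.
  rewrite addr0 [RHS]big_sub/=; apply: eq_bigr => s' _.
  rewrite (maxQ_Ecell _ cell) /Qfun coordE mulr_sumr.
  by apply: eq_bigr => j _; rewrite mulrA.
move=> s' /bigcupP nos'; apply/eqP; rewrite mulf_eq0; apply/orP; left.
by apply: contra_notT nos' => ts'; exists i => //; rewrite inE.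
Qed.

Lemma joint_Ecell (epsilon_gt0 : 0 < epsilon) (sigma_gt0 : 0 < sigma)
  (l : selector D) (theta : Theta M) : Ecell nu l theta ->
  joint nu epsilon sigma D theta =
  mvnormal_pdf 0 (invmx (Gammamx nu epsilon sigma l)) (rew D) *
  mvnormal_pdf (mu_post nu epsilon sigma l) (Sigma_post nu epsilon sigma l)
    (col_of_tuple theta).
Proof.
move=> cell; rewrite -gaussian_conditioning//; congr (_ * _).
  by apply: eq_bigr => i _; rewrite Bmx_Ecell.
by apply: eq_bigr => j _; rewrite mxE.
Qed.

Lemma measurable_joint : epsilon != 0 ->
  measurable_fun setT (joint nu epsilon sigma D).
Proof.
move=> e0; apply: measurable_funM; last first.
  apply: measurable_prod => j _.
  exact: measurableT_comp (measurable_normal_pdf 0 sigma) (measurable_tnth j).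
apply: measurable_prod => i _; apply: measurable_normal_pdf_mean => //.
apply: measurable_funB; first exact: measurable_coord.
apply: measurable_sum => s'; apply: measurable_funM => //.
by apply: measurable_bigmaxr => [|a]; exact: measurable_coord.
Qed.

Lemma joint_ge0 (theta : Theta M) : 0 <= joint nu epsilon sigma D theta.
Proof.
by rewrite mulr_ge0// prodr_ge0// => i _; exact: normal_pdf_ge0.
Qed.

(** The first index must be a genuine coordinate: two indices of constant value 0 are tied
    everywhere, which would make this set the whole space. *)
Definition ties : set (Theta M) :=
  \bigcup_(k in [set k : nu_index M * nu_index M |
                  (k.1 < dTheta M)%N && (k.1 != k.2)])
    [set theta | Defs.coord theta k.1 = Defs.coord theta k.2].

Lemma measurable_ties : measurable ties.
Proof.
apply: fin_bigcup_measurable => [|k _]; first exact: finite_finset.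
exact: measurable_coord_tie.
Qed.

Lemma null_ties : lebesgue_tuple R (dTheta M) ties = 0%E.
Proof.
apply/eqP; rewrite eq_le measure_ge0 andbT.
rewrite (le_trans (content_sub_fsum _ _ _ _ (fun _ => id))) => //.
- exact: finite_finset.
- by move=> k _; exact: measurable_coord_tie.
- exact: measurable_ties.
by rewrite fsbig1// => k /andP[k1 k12]; exact: null_coord_tie.
Qed.

(** A greedy selector exists at every [theta]. Two selectors valid at [theta] that differ at a state
    force a tie there, unless it is a goal state, where the action is unique. *)
Lemma unique_Ecell (nu_bij : bijective nu)
  (nu_goal : forall sa, tag sa \in goal M -> (dTheta M <= nu sa)%N)
  (theta : Theta M) : ~ ties theta -> exists! l : selector D, Ecell nu l theta.
Proof.
move=> noties.
pose l : selector D := finfun (fun s' : next_state D =>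
  [arg max_(a > action0 (val s')) Qfun nu theta (pair_of a)]%O).
exists l; split=> [|l'].
  apply/EcellP => s' a; rewrite /selected ffunE.
  by case: arg_maxP => // b _; apply.
have : Ecell nu l theta.
  apply/EcellP => s' a; rewrite /selected ffunE.
  by case: arg_maxP => // b _; apply.
move: l => l /EcellP cell /EcellP cell'; apply/ffunP => s'.
have [goal_s|nongoal_s] := boolP (val s' \in goal M).
  exact: action_goal_unique.
apply: contra_notP noties => /eqP ll'.
exists (nu (pair_of (l s')), nu (pair_of (l' s'))) => /=.
  rewrite nu_nongoal//= (inj_eq (bij_inj nu_bij)).
  by apply: contra ll'; rewrite eq_Tagged.
(* Each selected action is maximal, so neither value exceeds the other. *)
by apply/le_anti/andP; split; [exact: cell'|exact: cell].
Qed.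

End bellman_cells.

(** * Integrating the joint density cell by cell *)

(** Serves both formulas: [E = setT] gives the marginal, a general [E] the numerator of the
    posterior. *)
Lemma integral_joint (R : realType) (M : mdp R)
  (nu : state_action M -> nu_index M) (nu_bij : bijective nu)
  (nu_goal : forall sa, tag sa \in goal M -> (dTheta M <= nu sa)%N)
  (epsilon sigma : R) (epsilon_gt0 : 0 < epsilon) (sigma_gt0 : 0 < sigma)
  (n : nat) (D : n.-tuple (state_action M * R)) (E : set (Theta M)) :
  measurable E ->
  (\int[lebesgue_tuple R (dTheta M)]_(theta in E)
     (joint nu epsilon sigma D theta)%:E =
   \sum_(l : selector D)
     (mvnormal_pdf 0 (invmx (Gammamx nu epsilon sigma l)) (rew D))%:E *
     \int[lebesgue_tuple R (dTheta M)]_(theta in E `&` Ecell nu l)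
       (mvnormal_pdf (mu_post nu epsilon sigma l)
          (Sigma_post nu epsilon sigma l) (col_of_tuple theta))%:E)%E.
Proof.
move=> mE; have mj := measurable_joint nu sigma D (lt0r_neq0 epsilon_gt0).
rewrite (ge0_integral_almost_partition mE (@measurable_ties R M)
  (fun l : selector D => measurable_Ecell nu l) _ _ (@null_ties R M)) => [||theta|theta]; first last.
- exact: unique_Ecell.
- by rewrite lee_fin joint_ge0.
- exact/measurable_EFinP.
apply: eq_bigr => l _; set K := mvnormal_pdf 0 _ _.
have K0 : 0 < K by exact: mvnormal_pdf_evidence_gt0.
have mEl : measurable (E `&` Ecell nu l).
  by apply: measurableI => //; exact: measurable_Ecell.
rewrite -ge0_integralZl//; first last.
- by rewrite lee_fin ltW.
- by move=> theta _; rewrite lee_fin mulr_ge0 ?expR_ge0// invr_ge0 sqrtr_ge0.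
(* On the cell the conditional density is the joint density divided by the positive constant [K],
   and so inherits its measurability. *)
- apply/measurable_EFinP; apply: (eq_measurable_fun
    (fun theta => K^-1 * joint nu epsilon sigma D theta)) => [theta|].
    rewrite inE => -[_ cell].
    by rewrite (joint_Ecell epsilon_gt0 sigma_gt0 cell) mulKf// gt_eqF.
  by apply: measurable_funM => //; exact: measurable_funTS.
apply: eq_integral => theta; rewrite inE => -[_ cell].
by rewrite (joint_Ecell epsilon_gt0 sigma_gt0 cell) EFinM.
Qed.

Theorem theorem3 (R : realType) (M : mdp R)
  (goal_neq0 : goal M != finset.set0)
  (nu : state_action M -> nu_index M)
  (nu_bij : bijective nu)
  (nu_goal : forall sa, tag sa \in goal M -> (dTheta M <= nu sa)%N)
  (epsilon sigma : R) (epsilon_gt0 : 0 < epsilon) (sigma_gt0 : 0 < sigma)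
  (n : nat) (D : n.-tuple (state_action M * R))
  (D_uniq : uniq D)
  (D_nongoal : forall i, tag (sa_ D i) \notin goal M) :
  marginal nu epsilon sigma D =
    (\sum_(l : selector D)
       (mvnormal_pdf 0 (invmx (Gammamx nu epsilon sigma l)) (rew D))%:E *
       \int[lebesgue_tuple R (dTheta M)]_(theta in Ecell nu l)
         (mvnormal_pdf (mu_post nu epsilon sigma l)
            (Sigma_post nu epsilon sigma l) (col_of_tuple theta))%:E)%E
  /\
  forall E : set (Theta M), measurable E ->
  posterior_prob nu epsilon sigma D E =
    ((marginal nu epsilon sigma D)^-1 *
     \sum_(l : selector D)
       (mvnormal_pdf 0 (invmx (Gammamx nu epsilon sigma l)) (rew D))%:E *
       \int[lebesgue_tuple R (dTheta M)]_(theta in E `&` Ecell nu l)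
         (mvnormal_pdf (mu_post nu epsilon sigma l)
            (Sigma_post nu epsilon sigma l) (col_of_tuple theta))%:E)%E.
Proof.
split=> [|E mE].
  rewrite /marginal integral_joint//.
  by apply: eq_bigr => l _; rewrite setTI.
(* The inverse of the marginal is a nonnegative extended real constant, so it factors out of the
   integral. *)
rewrite -integral_joint// /posterior_prob /posterior ge0_integralZr// 1?muleC//.
- by apply: measurable_funTS; apply/measurable_EFinP;
    exact: measurable_joint (lt0r_neq0 epsilon_gt0).
- by move=> theta _; rewrite lee_fin joint_ge0.
- by rewrite inve_ge0 integral_ge0// => theta _; rewrite lee_fin joint_ge0.
Qed.
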